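(* Let $\eta\in\mathbb C\setminus\{0\}$, $\lambda_1,\lambda_2,\delta_1,\delta_2\in\mathbb C$, $I=K_{\lambda_1}\times K_{\lambda_2}$, $g(x)=\delta_1-\delta_2+\eta(\lambda_1-\lambda_2+x)$, and assume $g(k-\ell-n)\ne0$ whenever $n\ge1$ and $(\ell,k),(\ell+n,k-n)\in I$. Let $q_{\ell k}\neq 0$, $(\ell,k)\in I$, be arbitrary and $Q_{12}^{-1}|\ell,k\rangle=q_{\ell k}|\ell,k\rangle$. Then the operator $$F_{12}^{-1}=\Bigl(\sum_{n=0}^\infty\frac{(-\eta)^n}{n!}\,F^n\otimes E^n\prod_{j=1}^n\bigl(\delta_1-\delta_2+\eta(H\otimes1-1\otimes H)-\eta j\bigr)^{-1}\Bigr)Q_{12}^{-1}$$ on $V_{\lambda_1}(\delta_1)\otimes V_{\lambda_2}(\delta_2)$ satisfies, for all $(\ell,k)\in I$, $$F_{12}^{-1}|\ell,k\rangle=v_{\ell k}:=q_{\ell k}\sum_{n=0}^{k}\frac{(-\eta)^n}{n!}\Bigl(\prod_{j=1}^n\frac{f^{(1)}_{\ell+j-1}\,e^{(2)}_{k-j+1}}{g(k-\ell-j)}\Bigr)|\ell+n,k-n\rangle ,$$ i.e. it is the change of basis to the basis $(v_{\ell k})$ that diagonalizes $\Delta D(u)$ for all $u\in\mathbb C$.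
   Context: For $\lambda\in\mathbb C$, $V_\lambda$ is the highest weight $\mathfrak{sl}_2$-representation with basis $|k\rangle$, $k\in K_\lambda$, where $K_\lambda=\{0,\dots,2\lambda\}$ if $2\lambda\in\mathbb N_0$ and $K_\lambda=\mathbb N_0$ otherwise, and $H|k\rangle=(\lambda-k)|k\rangle$, $E|k\rangle=k|k-1\rangle$, $F|k\rangle=(2\lambda-k)|k+1\rangle$; $|k\rangle:=0$ if $k\notin K_\lambda$. The evaluation representation $V_\lambda(\delta)$ of the Yangian is $V_\lambda$ with $B(u)=\eta F$, $C(u)=\eta E$, $D(u)=u-\delta-\eta H$, and on $V_{\lambda_1}(\delta_1)\otimes V_{\lambda_2}(\delta_2)$ one has $\Delta D(u)=B(u)\otimes C(u)+D(u)\otimes D(u)$ (the $j$-th factor uses $\lambda_j,\delta_j$). Notation: $e^{(j)}_k=k$, $f^{(j)}_k=2\lambda_j-k$, $|\ell,k\rangle=|\ell\rangle\otimes|k\rangle$, zero if $(\ell,k)\notin I$; terms of a sum whose basis vector is zero are omitted. In particular the $n$-th term of the operator sum is understood to be zero on $|\ell,k\rangle$ if $F^n\otimes E^n|\ell,k\rangle=0$, so only finitely many terms act nontrivially on each vector. *)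

(* Defs.v *)
From HB Require Import structures.
From mathcomp Require Import all_boot all_order all_algebra.
From mathcomp Require Import boolp classical_sets fsbigop.
From mathcomp Require Import finmap monalg ring.

Set Implicit Arguments.
Unset Strict Implicit.
Unset Printing Implicit Defensive.

Import GRing.Theory.

Local Open Scope ring_scope.

(* {malg C[J]} is the free C-module on J (finitely supported functions J -> C)
   with basis vectors << j >>. *)
HB.lock Definition lext (C : fieldType) (J : choiceType) (W : lmodType C)
    (f : J -> W) (v : {malg C[J]}) : W :=
  \sum_(j <- msupp v) v@_j *: f j.

Section FreeModule.
Variables (C : fieldType) (J : choiceType).

Lemma lextEw (W : lmodType C) (f : J -> W) (v : {malg C[J]}) (D : {fset J}) :
  (msupp v `<=` D)%fset -> lext f v = \sum_(j <- D) v@_j *: f j.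
Proof.
move=> vD; rewrite lext.unlock (big_fset_incl _ vD) //= => j _.
by rewrite -mcoeff_eq0 => /eqP ->; rewrite scale0r.
Qed.

Lemma lext_is_linear (W : lmodType C) (f : J -> W) : linear (lext f).
Proof.
move=> a u v; set D := (msupp (a *: u + v) `|` (msupp u `|` msupp v))%fset.
rewrite !(@lextEw _ _ _ D) ?/D.
- rewrite scaler_sumr -big_split /=; apply: eq_bigr => j _.
  by rewrite mcoeffD mcoeffZ scalerDl scalerA.
- by rewrite fsetUA fsubsetUr.
- by rewrite fsetUCA fsubsetUl.
- by rewrite fsubsetUl.
Qed.

HB.instance Definition _ (W : lmodType C) (f : J -> W) :=
  GRing.isLinear.Build C {malg C[J]} W _ (lext f) (@lext_is_linear W f).

Lemma lextU (W : lmodType C) (f : J -> W) (j : J) : lext f << j >> = f j.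
Proof.
rewrite (@lextEw _ _ _ [fset j]%fset) ?msuppU_le //.
by rewrite big_seq_fset1 mcoeffUU scale1r.
Qed.

Definition is_basis (W : lmodType C) (v : J -> W) : Prop :=
  (forall c : {malg C[J]}, lext v c = 0 -> c = 0) /\
  (forall w : W, exists c : {malg C[J]}, lext v c = w).

End FreeModule.

HB.lock Definition otimes (C : fieldType) (J1 J2 : choiceType)
    (u : {malg C[J1]}) (v : {malg C[J2]}) : {malg C[(J1 * J2)%type]} :=
  \sum_(i <- msupp u) \sum_(j <- msupp v) << u@_i * v@_j *g (i, j) >>.

Section TensorProduct.
Variables (C : fieldType) (J1 J2 : choiceType).

(* Only meaningful for linear A and B. *)
Definition optens (A : {malg C[J1]} -> {malg C[J1]})
    (B : {malg C[J2]} -> {malg C[J2]}) :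
    {malg C[(J1 * J2)%type]} -> {malg C[(J1 * J2)%type]} :=
  lext (fun x : J1 * J2 => otimes (A << x.1 >>) (B << x.2 >>)).

Lemma optensZ A B c v : optens A B (c *: v) = c *: optens A B v.
Proof. exact: linearZ. Qed.

End TensorProduct.

Section OtimesTheory.
Variables (C : fieldType) (J1 J2 : choiceType).
Implicit Types (u : {malg C[J1]}) (v : {malg C[J2]}).

Lemma otimes_coef u v i j : (otimes u v)@_(i, j) = u@_i * v@_j.
Proof.
have sumU (J : choiceType) (w : {malg C[J]}) (l : J) (F : J -> C) :
    (forall l', l' != l -> F l' = 0) -> (w@_l = 0 -> F l = 0) ->
    \sum_(l' <- msupp w) F l' = F l.
  move=> F0 wF; have [lw|lw] := boolP (l \in msupp w).
    by rewrite (big_fsetD1 l) //= big1_fset ?addr0 // => l' /fsetD1P[/F0].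
  rewrite wF ?mcoeff_outdom // big1_fset // => l' l'w _; apply: F0.
  by apply: contraNneq lw => <-.
rewrite otimes.unlock raddf_sum /= (sumU _ u i); last 2 first.
- move=> i' ii'; rewrite raddf_sum big1 // => j' _.
  by rewrite /= mcoeffU xpair_eqE (negbTE ii').
- by move=> u0; rewrite raddf_sum big1 // => j' _; rewrite /= mcoeffU u0 mul0r mul0rn.
rewrite raddf_sum /= (sumU _ v j); first by rewrite mcoeffUU.
- by move=> j' jj'; rewrite mcoeffU xpair_eqE (negbTE jj') andbF.
- by move=> v0; rewrite mcoeffUU v0 mulr0.
Qed.

Lemma otimesU (i : J1) (j : J2) :
  otimes << i >> << j >> = << (i, j) >> :> {malg C[(J1 * J2)%type]}.
Proof.
apply/malgP => -[i' j']; rewrite otimes_coef !mcoeffU xpair_eqE.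
by case: (i == i'); rewrite ?mul0r // mul1r.
Qed.

Lemma otimesZl c u v : otimes (c *: u) v = c *: otimes u v.
Proof. by apply/malgP => -[i j]; rewrite mcoeffZ !otimes_coef mcoeffZ mulrA. Qed.

Lemma otimesZr c u v : otimes u (c *: v) = c *: otimes u v.
Proof. by apply/malgP => -[i j]; rewrite mcoeffZ !otimes_coef mcoeffZ mulrCA. Qed.

Lemma otimes0l v : otimes (0 : {malg C[J1]}) v = 0.
Proof. by rewrite -[X in otimes X](scale0r 0) otimesZl scale0r. Qed.

Lemma otimes0r u : otimes u (0 : {malg C[J2]}) = 0.
Proof. by rewrite -[X in otimes _ X](scale0r 0) otimesZr scale0r. Qed.

End OtimesTheory.

Section DiagonalInverse.
Variables (C : fieldType) (J : choiceType).

(* The inverse of an operator T which is diagonal in the basis << j >>.  The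
   eigenvalue is read off from T; where it vanishes the value is 0, and T is
   only inverted on the span of the other basis vectors (see diaginvK). *)
Definition diaginv (T : {malg C[J]} -> {malg C[J]}) :
    {malg C[J]} -> {malg C[J]} :=
  lext (fun j : J => ((T << j >>)@_j)^-1 *: << j >>).

Lemma diaginvK (T : {malg C[J]} -> {malg C[J]}) (j : J) (c : C) :
  scalable T -> T << j >> = c *: << j >> -> c != 0 ->
  T (diaginv T << j >>) = << j >> /\ diaginv T (T << j >>) = << j >>.
Proof.
move=> TZ Tj c0; have E : diaginv T << j >> = c^-1 *: << j >>.
  by rewrite /diaginv lextU Tj mcoeffZ mcoeffUU mulr1.
split; first by rewrite E TZ Tj scalerA mulVf // scale1r.
by rewrite Tj /diaginv linearZ /= -/(diaginv T _) E scalerA mulfV // scale1r.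
Qed.

End DiagonalInverse.

Unset Implicit Arguments.

Section Yangian.
Context {C : fieldType}.

Implicit Types lam delta eta u : C.

(* If 2 lam = N is a natural number then k <= N; otherwise no condition. *)
Definition Kset lam : {pred nat} :=
  fun k => `[< forall N : nat, 2%:R * lam = N%:R -> (k <= N)%N >].

Definition K lam : choiceType := {k : nat | k \in Kset lam}.

Local Notation V lam := {malg C[K lam]}.

(* |k>, equal to 0 when k is not in K_lam *)
Definition ket lam (k : nat) : V lam :=
  if insub k is Some x then << (x : K lam) >> else 0.

Definition ecoef (k : nat) : C := k%:R.
Definition fcoef lam (k : nat) : C := 2%:R * lam - k%:R.

Definition opH lam : V lam -> V lam :=
  lext (fun x : K lam => (lam - (val x)%:R) *: ket lam (val x)).
(* For k = 0 the truncated predecessor is harmless since the coefficient is 0. *)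
Definition opE lam : V lam -> V lam :=
  lext (fun x : K lam => ecoef (val x) *: ket lam (val x).-1).
Definition opF lam : V lam -> V lam :=
  lext (fun x : K lam => fcoef lam (val x) *: ket lam (val x).+1).

Definition evB eta lam : V lam -> V lam := eta \*: opF lam.
Definition evC eta lam : V lam -> V lam := eta \*: opE lam.
Definition evD eta lam delta u : V lam -> V lam :=
  (u - delta) \*: idfun \- eta \*: opH lam.

Section TwoSites.
Variables eta lam1 lam2 delta1 delta2 : C.

Local Notation I := (K lam1 * K lam2)%type.
Local Notation V12 := {malg C[(K lam1 * K lam2)%type]}.

Definition ket2 (l k : nat) : V12 := otimes (ket lam1 l) (ket lam2 k).

Definition DeltaD u : V12 -> V12 :=
  optens (evB eta lam1) (evC eta lam2) \+
  optens (evD eta lam1 delta1 u) (evD eta lam2 delta2 u).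

Definition gfun (x : C) : C := delta1 - delta2 + eta * (lam1 - lam2 + x).

Definition Qinv (q : nat -> nat -> C) : V12 -> V12 :=
  lext (fun x : I => q (val x.1) (val x.2) *: << x >>).

Definition denom (j : nat) : V12 -> V12 :=
  (delta1 - delta2) \*: idfun
  \+ eta \*: (optens (opH lam1) idfun \- optens idfun (opH lam2))
  \- (eta * j%:R) \*: idfun.

Definition FEpow (n : nat) : V12 -> V12 :=
  optens (iter n (opF lam1)) (iter n (opE lam2)).

(* The n-th term is 0 on |l,k> when F^n (x) E^n |l,k> = 0, whether or not the
   factors denom j are invertible there; see denomK for the other vectors. *)
Definition Fterm (n : nat) : V12 -> V12 :=
  lext (fun x : I =>
    if FEpow n << x >> == 0 then 0
    else ((- eta) ^+ n / n`!%:R) *: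
      FEpow n ((\big[(fun S T : V12 -> V12 => S \o T)/idfun]_(1 <= j < n.+1)
                  diaginv (denom j)) << x >>)).

(* Pointwise sum: on each vector only finitely many terms are nonzero. *)
Definition Finv (q : nat -> nat -> C) : V12 -> V12 :=
  fun w => \sum_(n \in [set: nat]) Fterm n (Qinv q w).

Definition vvec (q : nat -> nat -> C) (l k : nat) : V12 :=
  q l k *: \sum_(0 <= n < k.+1)
    ((- eta) ^+ n / n`!%:R *
     \prod_(1 <= j < n.+1)
       (fcoef lam1 (l + j - 1) * ecoef (k - j + 1)
        / gfun (k%:R - l%:R - j%:R))) *: ket2 (l + n) (k - n).

End TwoSites.

Lemma ketE lam (x : K lam) : ket lam (val x) = << x >>.
Proof. by rewrite /ket valK. Qed.

Lemma ket_out lam k : k \notin Kset lam -> ket lam k = 0.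
Proof. by move=> h; rewrite /ket insubF //; apply/negbTE. Qed.

Lemma opEZ lam c v : opE lam (c *: v) = c *: opE lam v.
Proof. exact: linearZ. Qed.

Lemma opFZ lam c v : opF lam (c *: v) = c *: opF lam v.
Proof. exact: linearZ. Qed.

Lemma opE_ket lam k : exists c,
  opE lam (ket lam k) = (if (0 < k)%N then c else 0) *: ket lam k.-1.
Proof.
case: (boolP (k \in Kset lam)) => [kK|/ket_out ->]; last first.
  by exists 0; rewrite /opE linear0 if_same scale0r.
exists (ecoef k); rewrite -[k]/(val (Sub k kK : K lam)) ketE /opE lextU /=.
by case: k kK => //= _; rewrite /ecoef.
Qed.

Lemma opF_ket lam k : exists c, opF lam (ket lam k) = c *: ket lam k.+1.
Proof.
case: (boolP (k \in Kset lam)) => [kK|/ket_out ->]; last first.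
  by exists 0; rewrite /opF linear0 scale0r.
by exists (fcoef lam k); rewrite -[k]/(val (Sub k kK : K lam)) ketE /opF lextU.
Qed.

Lemma iter_opE lam n (x : K lam) :
  exists c, iter n (opE lam) << x >> =
    (if (n <= val x)%N then c else 0) *: ket lam (val x - n).
Proof.
elim: n => [|n [c IH]]; first by exists 1; rewrite /= subn0 scale1r ketE.
have [d Ed] := opE_ket lam (val x - n).
exists (c * d); rewrite iterS IH opEZ Ed scalerA subnS subn_gt0.
have {IH Ed} -> : (if (n <= val x)%N then c else 0) *
    (if (n < val x)%N then d else 0) = if (n < val x)%N then c * d else 0.
  by case: (ltnP n (val x)) => [/ltnW -> //|_]; rewrite mulr0.
exact: erefl.
Qed.

Lemma iter_opF lam n (x : K lam) :
  exists c, iter n (opF lam) << x >> = c *: ket lam (val x + n).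
Proof.
elim: n => [|n [c IH]]; first by exists 1; rewrite /= addn0 scale1r ketE.
have [d Ed] := opF_ket lam (val x + n).
exists (c * d); rewrite iterS IH opFZ Ed scalerA addnS; exact: erefl.
Qed.

Lemma FEpow_neq0 lam1 lam2 n (x : K lam1 * K lam2) :
  FEpow lam1 lam2 n << x >> != 0 ->
  [/\ (n <= val x.2)%N, (val x.1 + n)%N \in Kset lam1
    & (val x.2 - n)%N \in Kset lam2].
Proof.
rewrite /FEpow /optens lextU.
have [c ->] := iter_opF lam1 n x.1; have [d ->] := iter_opE lam2 n x.2.
case: leqP => nx; last by rewrite scale0r otimes0r eqxx.
case: (boolP (_ \in Kset lam1)) => [//|/ket_out ->]; last first.
  by rewrite scaler0 otimes0l eqxx.
case: (boolP (_ \in Kset lam2)) => [//|/ket_out ->].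
by rewrite scaler0 otimes0r eqxx.
Qed.

Lemma denomE eta lam1 lam2 delta1 delta2 (j : nat) (x : K lam1 * K lam2) :
  denom eta lam1 lam2 delta1 delta2 j << x >> =
  gfun eta lam1 lam2 delta1 delta2
    ((val x.2)%:R - (val x.1)%:R - j%:R) *: << x >>.
Proof.
rewrite /denom /GRing.add_fun /GRing.sub_fun /GRing.scale_fun /= /optens.
rewrite !lextU /opH !lextU !ketE otimesZl otimesZr.
have eqZ (W : lmodType C) (w : W) (a b c d e : C) :
    a *: w + e *: (b *: w - c *: w) - d *: w = (a + e * (b - c) - d) *: w.
  by rewrite scalerBl scalerDl -scalerA scalerBl.
case: x => l k /=; rewrite otimesU eqZ.
suff -> :
    gfun eta lam1 lam2 delta1 delta2 ((sval k)%:R - (sval l)%:R - j%:R) =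
    delta1 - delta2 + eta * (lam1 - (sval l)%:R - (lam2 - (sval k)%:R))
      - eta * j%:R by [].
by rewrite /gfun; ring.
Qed.

Lemma denomZ eta lam1 lam2 delta1 delta2 j :
  scalable (denom eta lam1 lam2 delta1 delta2 j).
Proof.
have eqZ (W : lmodType C) (w w1 w2 : W) (a e d c : C) :
    a *: (c *: w) + e *: (c *: w1 - c *: w2) - d *: (c *: w) =
    c *: (a *: w + e *: (w1 - w2) - d *: w).
  rewrite -[c *: w1 - _]scalerBr [RHS]scalerBr [in RHS]scalerDr.
  by rewrite !scalerA !(mulrC c).
move=> c v; rewrite /denom /GRing.add_fun /GRing.sub_fun /GRing.scale_fun /=.
rewrite !optensZ; exact: eqZ.
Qed.

Lemma Kset_le lam m n : (m <= n)%N -> n \in Kset lam -> m \in Kset lam.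
Proof.
move=> mn /asboolP nK; apply/asboolP => N /nK; exact: leq_trans.
Qed.

(* Every inverse that occurs in a nonzero term of the series is genuine. *)
Lemma denomK eta lam1 lam2 delta1 delta2 (n j : nat) (x : K lam1 * K lam2) :
  (forall m l k : nat, (1 <= m)%N -> (m <= k)%N ->
     l \in Kset lam1 -> k \in Kset lam2 ->
     (l + m)%N \in Kset lam1 -> (k - m)%N \in Kset lam2 ->
     gfun eta lam1 lam2 delta1 delta2 (k%:R - l%:R - m%:R) != 0) ->
  FEpow lam1 lam2 n << x >> != 0 -> (1 <= j <= n)%N ->
  let T := denom eta lam1 lam2 delta1 delta2 j in
  T (diaginv T << x >>) = << x >> /\ diaginv T (T << x >>) = << x >>.
Proof.
move=> g_neq0 /FEpow_neq0 [nk lK kK] /andP [j1 jn] T.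
apply: diaginvK; [exact: denomZ | exact: denomE |].
apply: g_neq0 => //; first exact: leq_trans nk.
- exact: valP.
- exact: valP.
- by apply: Kset_le lK; rewrite leq_add2l.
- by apply: Kset_le (valP x.2); rewrite leq_subr.
Qed.
End Yangian.

(* Main.v *)
(* Write v_{lk} = q_{lk} sum_n c_n |l+n,k-n>.  If F^n (x) E^n kills |l,k>, the
   product of its ladder coefficients times |l+n,k-n> is zero, so that
   F_12^{-1} |l,k> = v_{lk} holds term by term, whether or not g vanishes.
   The v_{lk} are triangular with nonzero diagonal q_{lk}, hence a basis:
   independence goes by induction on l, generation by induction on k.
   Finally Delta D(u) maps |l+n,k-n> to d_n |l+n,k-n> plus
   eta^2 f_{l+n} e_{k-n} |l+n+1,k-n-1>, and d_0 - d_n = - eta n g(k-l-n); with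
   the ratio c_{n+1} / c_n this makes v_{lk} an eigenvector for d_0. *)
Require Import Defs.
From mathcomp Require Import all_boot all_order all_algebra.
From mathcomp Require Import boolp classical_sets fsbigop reals.
From mathcomp Require Import finmap monalg complex ring.

Local Open Scope ring_scope.

Import GRing.Theory Num.Theory.

(** * Generators and diagonal inverses on weight vectors *)

Section Ladder.
Context {C : fieldType}.
Implicit Types (lam : C) (l k n : nat).

Lemma KsetP lam k : reflect (exists x : K lam, val x = k) (k \in Kset lam).
Proof.
apply: (iffP idP) => [kK|[x <-]]; last exact: valP x.
by exists (Sub k kK); rewrite SubK.
Qed.

(** Membership matters: if [k] is one past the top index of a finite [Kset lam], then [ket lam k] is
    zero but [ket lam k.-1] is not. *)
Lemma opE_ketE lam k : k \in Kset lam ->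
  opE lam (ket lam k) = ecoef k *: ket lam k.-1.
Proof. by case/KsetP => x <-; rewrite ketE /opE lextU. Qed.

(** [Kset lam] is closed downward, so if [l] lies outside it, so does [l.+1], and both sides
    vanish. *)
Lemma opF_ketE lam l : opF lam (ket lam l) = fcoef lam l *: ket lam l.+1.
Proof.
have [/KsetP[x <-]|lK] := boolP (l \in Kset lam).
  by rewrite ketE /opF lextU.
rewrite ket_out // ket_out ?scaler0 ?/opF ?linear0 //.
by apply: contraNN lK; apply: Kset_le.
Qed.

Lemma opH_ketE lam k : opH lam (ket lam k) = (lam - k%:R) *: ket lam k.
Proof.
have [/KsetP[x <-]|kK] := boolP (k \in Kset lam).
  by rewrite ketE /opH lextU ketE.
by rewrite ket_out // /opH linear0 scaler0.
Qed.

Lemma iter_opF_ketE lam l n :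
  iter n (opF lam) (ket lam l) =
    (\prod_(1 <= j < n.+1) fcoef lam (l + j - 1)) *: ket lam (l + n).
Proof.
elim: n => [|n IH]; first by rewrite big_nil addn0 scale1r.
have ln : (l + n.+1 - 1)%N = (l + n)%N by rewrite addnS subn1.
rewrite iterS IH {IH} opFZ opF_ketE scalerA [in RHS]big_nat_recr /=; last by [].
by rewrite ln addnS.
Qed.

Lemma iter_opE_ketE lam k n : k \in Kset lam -> (n <= k)%N ->
  iter n (opE lam) (ket lam k) =
    (\prod_(1 <= j < n.+1) ecoef (k - j + 1)) *: ket lam (k - n).
Proof.
move=> kK; elim: n => [|n IH] nk; first by rewrite big_nil subn0 scale1r.
rewrite iterS (IH (ltnW nk)) {IH} opEZ opE_ketE; last first.
  exact: Kset_le (leq_subr _ _) kK.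
have kn : (k - n.+1 + 1)%N = (k - n)%N by rewrite addn1 subnSK.
rewrite scalerA [in RHS]big_nat_recr /=; last by [].
by rewrite kn subnS.
Qed.

Lemma malgU_scale (J : choiceType) (c : C) (j : J) :
  << c *g j >> = c *: << j >>.
Proof. by apply/malgP => i; rewrite mcoeffZ !mcoeffU mulr_natr. Qed.

Lemma otimesZZ (J1 J2 : choiceType) (a b : C) (u : {malg C[J1]})
    (v : {malg C[J2]}) :
  otimes (a *: u) (b *: v) = (a * b) *: otimes u v.
Proof. by rewrite otimesZl otimesZr scalerA. Qed.

Lemma optens_ket2 {lam1 lam2 : C} {A : {malg C[K lam1]} -> {malg C[K lam1]}}
    {B : {malg C[K lam2]} -> {malg C[K lam2]}} {l k} :
  l \in Kset lam1 -> k \in Kset lam2 ->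
  optens A B (ket2 lam1 lam2 l k) = otimes (A (ket lam1 l)) (B (ket lam2 k)).
Proof.
by move=> /KsetP[x <-] /KsetP[y <-]; rewrite /ket2 !ketE otimesU /optens lextU.
Qed.

Lemma ket2E {lam1 lam2 : C} (x : K lam1 * K lam2) :
  ket2 lam1 lam2 (val x.1) (val x.2) = << x >>.
Proof. by rewrite /ket2 !ketE otimesU; case: x. Qed.

Lemma ket2_out1 lam1 lam2 l k : l \notin Kset lam1 -> ket2 lam1 lam2 l k = 0.
Proof. by move=> lK; rewrite /ket2 ket_out // otimes0l. Qed.

(** For [c = 0] both sides vanish, by the convention [0^-1 = 0]. *)
Lemma diaginv_eigen (J : choiceType) (T : {malg C[J]} -> {malg C[J]}) j c :
  T << j >> = c *: << j >> -> diaginv T << j >> = c^-1 *: << j >>.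
Proof. by move=> Tj; rewrite /diaginv lextU Tj mcoeffZ mcoeffUU mulr1. Qed.

Lemma diaginvZ (J : choiceType) (T : {malg C[J]} -> {malg C[J]}) a v :
  diaginv T (a *: v) = a *: diaginv T v.
Proof. exact: linearZ. Qed.

(** * Coefficients and terms of the series on basis vectors *)

Context {eta lam1 lam2 delta1 delta2 : C}.
Implicit Types q : nat -> nat -> C.

Local Notation g := (gfun eta lam1 lam2 delta1 delta2).
Local Notation ket2 := (ket2 lam1 lam2).

Definition vcoef l k n : C :=
  (- eta) ^+ n / n`!%:R *
  \prod_(1 <= j < n.+1)
     (fcoef lam1 (l + j - 1) * ecoef (k - j + 1) / g (k%:R - l%:R - j%:R)).

Lemma vcoef0 l k : vcoef l k 0 = 1.
Proof. by rewrite /vcoef big_nil mulr1 divr1. Qed.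

(** The bound [n < k] makes the truncated [k - n.+1 + 1] equal to [k - n]. *)
Lemma vcoefS l k n : (n < k)%N ->
  vcoef l k n.+1 = vcoef l k n *
    (- eta / n.+1%:R *
     (fcoef lam1 (l + n) * ecoef (k - n) / g (k%:R - l%:R - n.+1%:R))).
Proof.
move=> nk; rewrite /vcoef big_nat_recr /=; last by [].
have ln : (l + n.+1 - 1)%N = (l + n)%N by rewrite addnS subn1.
have kn : (k - n.+1 + 1)%N = (k - n)%N by rewrite addn1 subnSK.
rewrite ln kn exprSr factS natrM invfM.
move: (\prod_(1 <= i < n.+1) _) (_ ^+ n) (n`!%:R^-1) (n.+1%:R^-1) (_ / g _).
by move=> P a b c x; ring.
Qed.

Lemma vvecE q l k :
  vvec eta lam1 lam2 delta1 delta2 q l k =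
    q l k *: \sum_(0 <= n < k.+1) vcoef l k n *: ket2 (l + n) (k - n).
Proof. by []. Qed.

Lemma prod_diaginvE n (x : K lam1 * K lam2) :
  (\big[(fun S T => S \o T)/idfun]_(1 <= j < n.+1)
     diaginv (denom eta lam1 lam2 delta1 delta2 j)) << x >> =
  (\prod_(1 <= j < n.+1)
     (g ((val x.2)%:R - (val x.1)%:R - j%:R))^-1) *: << x >>.
Proof.
(* Over an arbitrary index list, [big_cons] peels off the outermost operator, and the inner ones
   only rescale [<< x >>]. *)
rewrite /index_iota; elim: (iota _ _) => [|j s IH].
  by rewrite !big_nil scale1r.
rewrite !big_cons /comp IH {IH} diaginvZ.
rewrite (diaginv_eigen _ _ x _ (denomE _ _ _ _ _ _ _)).
by rewrite scalerA [X in X *: _ = _]mulrC.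
Qed.

(** The ladder coefficients of [F^n] and [E^n] and the inverse eigenvalues of [denom] multiply to
    [vcoef]. Beyond [n = val x.2] a separate branch is needed: with truncated subtraction every
    [k - j + 1] is positive, so [vcoef] need not vanish there. *)
Lemma Fterm_ketE n (x : K lam1 * K lam2) :
  Fterm eta lam1 lam2 delta1 delta2 n << x >> =
  if (n <= val x.2)%N then
    vcoef (val x.1) (val x.2) n *: ket2 (val x.1 + n) (val x.2 - n) else 0.
Proof.
rewrite /Fterm lextU prod_diaginvE {2}/FEpow optensZ -/(FEpow _ _ _ _).
set t := _ *: (_ *: _).
(* [t] is a multiple of [FEpow lam1 lam2 n << x >>], so it is zero in the first branch as well. *)
have -> : (if FEpow lam1 lam2 n << x >> == 0 then 0 else t) = t.
  by case: eqP => // FE0; rewrite /t FE0 !scaler0.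
rewrite {}/t; case: leqP => nx; last first.
  suff -> : FEpow lam1 lam2 n << x >> = 0 by rewrite !scaler0.
  by apply/eqP; apply: contraLR nx => /FEpow_neq0[nx _ _]; rewrite -leqNgt.
rewrite /FEpow -ket2E (optens_ket2 (valP x.1) (valP x.2)).
rewrite iter_opF_ketE (iter_opE_ketE _ _ _ (valP x.2) nx).
rewrite otimesZl otimesZr !scalerA -/(ket2 _ _) /vcoef !big_split /=.
by rewrite -mulrA [X in _ * X *: _ = _]mulrC.
Qed.

(** * Linearity and local finiteness of the series *)

Lemma Fterm_linear n : linear (Fterm eta lam1 lam2 delta1 delta2 n).
Proof. by move=> a u v; rewrite /Fterm linearP. Qed.

Lemma FtermZ n a v : Fterm eta lam1 lam2 delta1 delta2 n (a *: v) =
  a *: Fterm eta lam1 lam2 delta1 delta2 n v.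
Proof. exact: linearZ. Qed.

Lemma Qinv_linear q : linear (Qinv lam1 lam2 q).
Proof. by move=> a u v; rewrite /Qinv linearP. Qed.

Lemma Fterm_eventually0 (w : {malg C[(K lam1 * K lam2)%type]}) :
  exists N, forall n, (N <= n)%N -> Fterm eta lam1 lam2 delta1 delta2 n w = 0.
Proof.
(* One more than the largest second index in the support: from there on [E^n] kills every basis
   vector involved. *)
exists (\max_(x <- msupp w) (val x.2).+1) => n Nn.
rewrite {1}/Fterm lext.unlock big1_seq // => x /andP[_ xw].
have := Fterm_ketE n x; rewrite {1}/Fterm lextU => ->.
have := @leq_bigmax_seq _ _ predT (fun y => (val y.2).+1) x xw isT.
move=> /leq_trans/(_ Nn).
by rewrite ltnNge => /negbTE ->; rewrite scaler0.
Qed.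

(** The sum in [Finv] would default to zero on infinite support. Since the cutoff [N] is free,
    several vectors can share one. *)
Lemma FinvE {q w N} :
  (forall n, (N <= n)%N ->
     Fterm eta lam1 lam2 delta1 delta2 n (Qinv lam1 lam2 q w) = 0) ->
  Finv eta lam1 lam2 delta1 delta2 q w =
    \sum_(0 <= n < N) Fterm eta lam1 lam2 delta1 delta2 n (Qinv lam1 lam2 q w).
Proof.
move=> FN; rewrite /Finv (fsbigE (index_iota 0 N)) ?iota_uniq //.
- by apply: eq_bigl => n; rewrite in_setT.
- by move=> n _; rewrite mem_index_iota /= -leqNgt => /FN.
Qed.

Lemma Finv_linear q : linear (Finv eta lam1 lam2 delta1 delta2 q).
Proof.
move=> a v w.
have [N1 F1] := Fterm_eventually0 (Qinv lam1 lam2 q v).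
have [N2 F2] := Fterm_eventually0 (Qinv lam1 lam2 q w).
have F1' n : (maxn N1 N2 <= n)%N ->
    Fterm eta lam1 lam2 delta1 delta2 n (Qinv lam1 lam2 q v) = 0.
  by rewrite geq_max => /andP[/F1].
have F2' n : (maxn N1 N2 <= n)%N ->
    Fterm eta lam1 lam2 delta1 delta2 n (Qinv lam1 lam2 q w) = 0.
  by rewrite geq_max => /andP[_ /F2].
rewrite (FinvE F1') (FinvE F2') (@FinvE _ _ (maxn N1 N2)); last first.
  by move=> n Nn; rewrite Qinv_linear Fterm_linear F1' // F2' // scaler0 addr0.
rewrite scaler_sumr -big_split /=; apply: eq_bigr => n _.
by rewrite Qinv_linear Fterm_linear.
Qed.

Lemma Finv_ket2 q l k : l \in Kset lam1 -> k \in Kset lam2 ->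
  Finv eta lam1 lam2 delta1 delta2 q (ket2 l k) =
  vvec eta lam1 lam2 delta1 delta2 q l k.
Proof.
move=> /KsetP[x <-] /KsetP[y <-]; rewrite (ket2E (x, y)).
have QE : Qinv lam1 lam2 q << (x, y) >> = q (val x) (val y) *: << (x, y) >>.
  by rewrite /Qinv lextU.
have FE n :
    Fterm eta lam1 lam2 delta1 delta2 n (Qinv lam1 lam2 q << (x, y) >>) =
    q (val x) (val y) *: Fterm eta lam1 lam2 delta1 delta2 n << (x, y) >>.
  by rewrite QE FtermZ {QE}.
rewrite (@FinvE _ _ (val y).+1) => [|n nk].
  rewrite vvecE scaler_sumr; apply: eq_big_nat => n /andP[_ nk].
  by rewrite FE {QE FE} Fterm_ketE -ltnS nk.
by rewrite FE {QE FE} Fterm_ketE leqNgt nk scaler0.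
Qed.

(** * Triangularity and the basis property *)

Lemma vvec_coef q l k (y : K lam1 * K lam2) :
  (vvec eta lam1 lam2 delta1 delta2 q l k)@_y =
  q l k * \sum_(0 <= n < k.+1)
    vcoef l k n * ((val y.1 == l + n)%N && (val y.2 == k - n)%N)%:R.
Proof.
rewrite vvecE mcoeffZ raddf_sum; congr (_ * _); apply: eq_bigr => n _ /=.
have ketC lam m (x : K lam) : (ket lam m)@_x = (val x == m)%:R.
  have [/KsetP[z <-]|mK] := boolP (m \in Kset lam).
    by rewrite ketE mcoeffU eq_sym.
  rewrite ket_out // mcoeff0; case: eqP => // xm.
  by rewrite -xm (valP x) in mK.
by case: y => y1 y2; rewrite mcoeffZ otimes_coef !ketC -natrM mulnb.
Qed.

Lemma vvec_basis q :
  (forall l k, l \in Kset lam1 -> k \in Kset lam2 -> q l k != 0) ->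
  is_basis (fun x : K lam1 * K lam2 =>
    vvec eta lam1 lam2 delta1 delta2 q (val x.1) (val x.2)).
Proof.
move=> q0; set v := (fun x => _); split=> [c vc0|w].
  have c0 m (x : K lam1 * K lam2) : (val x.1 < m)%N -> c@_x = 0.
    elim: m x => // m IH x; rewrite ltnS => xm.
    have /eqP := congr1 (mcoeff x) vc0; rewrite mcoeff0.
    (* [x] is adjoined to the support so that its term can be split off even when [c@_x] is zero. *)
    rewrite (@lextEw _ _ _ _ _ (x |` msupp c)%fset) ?fsubsetU1 //.
    rewrite (big_fsetD1 x) ?fset1U1 //= mcoeffD.
    rewrite [X in _ + X]raddf_sum [X in _ + X]big1_fset /=.
      (* Only [n = 0] contributes to the diagonal coefficient, which is therefore the nonzero
         [q]. *)
      rewrite addr0 mcoeffZ vvec_coef big_nat_recl // big_nat big1.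
        rewrite addn0 subn0 !eqxx vcoef0 mulr1 addr0 mulr1 mulf_eq0.
        by rewrite (negPf (q0 _ _ (valP x.1) (valP x.2))) orbF => /eqP.
      by move=> n _; rewrite ltn_eqF ?mulr0 // addnS ltnS leq_addr.
    move=> y /fsetD1P[yx _] _; rewrite mcoeffZ vvec_coef.
    have [ylt|yge] := ltnP (val y.1) (val x.1).
      by rewrite IH ?mul0r // (leq_trans ylt).
    rewrite big1 ?mulr0 // => n _.
    case: andP => [[/eqP xy /eqP xy2]|]; last by rewrite mulr0.
    (* Since [val x.1 <= val y.1], equality with [val y.1 + n] leaves only [n = 0], and then
       [x = y]. *)
    have n0 : n = 0%N.
      by apply/eqP; rewrite -leqn0 -(leq_add2l (val y.1)) -xy addn0.
    case/eqP: yx; move: xy xy2; rewrite n0 addn0 subn0.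
    by case: x y {IH xm yge} => x1 x2 [y1 y2] /= /val_inj -> /val_inj ->.
  by apply/malgP => x; rewrite (c0 (val x.1).+1) // mcoeff0.
have span_lin a u u' : (exists c, lext v c = u) -> (exists c, lext v c = u') ->
    exists c, lext v c = a *: u + u'.
  by move=> [c <-] [c' <-]; exists (a *: c + c'); rewrite linearP.
have span0 : exists c, lext v c = 0 by exists 0; rewrite linear0.
(* The induction runs over all [l], including those outside [Kset lam1], because the tail of
   [v_{lk}] lowers [k] while raising [l]. *)
have span_ket m l k : (k < m)%N -> exists c, lext v c = ket2 l k.
  elim: m l k => // m IH l k; rewrite ltnS => km.
  have [/KsetP[x xl]|lK] := boolP (l \in Kset lam1); last by rewrite ket2_out1.
  have [/KsetP[y yk]|kK] := boolP (k \in Kset lam2); last first.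
    by rewrite /Defs.ket2 [X in otimes _ X]ket_out // otimes0r.
  have ql : q l k != 0 by apply: q0; rewrite -?xl -?yk; apply: valP.
  (* The tail of [v_{lk} / q_{lk}] after its leading vector [ket2 l k]. *)
  pose t := \sum_(0 <= n < k) vcoef l k n.+1 *: ket2 (l + n.+1) (k - n.+1).
  suff [c Ec] : exists c, lext v c = - t.
    have -> : ket2 l k = (q l k)^-1 *: v (x, y) - t.
      rewrite /v /= xl yk vvecE scalerA mulVf // scale1r big_nat_recl //.
      by rewrite vcoef0 scale1r addn0 subn0 addrK.
    by apply: span_lin; [exists << (x, y) >>; rewrite lextU | exists c].
  rewrite /t -sumrN big_seq; elim/big_rec: _ => // n u nk uP.
  rewrite -scaleNr; apply: span_lin => //; apply: IH.
  by move: nk; rewrite mem_index_iota => /= nk; apply: leq_trans km;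
    rewrite ltn_subrL /= (leq_trans _ nk).
rewrite [w]monalgE; elim/big_rec: _ => // x u _ uP.
rewrite malgU_scale; apply: span_lin => //.
by rewrite -ket2E; apply: span_ket (ltnSn _).
Qed.

(** * Eigenvectors of [DeltaD u] *)

(** The eigenvalue on [|l,k>] of the diagonal summand of [DeltaD u], the tensor product of the two
    [D(u)]. *)
Definition deigen u l k : C :=
  (u - delta1 - eta * (lam1 - l%:R)) * (u - delta2 - eta * (lam2 - k%:R)).

(** The two factors shift by [eta * m] and [- (eta * m)], so only the difference of the factors
    enters, and there [u] cancels. This is why the same vectors serve for all [u]. *)
Lemma deigenB u l k m : (m <= k)%N ->
  deigen u l k - deigen u (l + m) (k - m) =
    - (eta * m%:R * g (k%:R - l%:R - m%:R)).
Proof. by move=> mk; rewrite /deigen /gfun natrD natrB //; ring. Qed.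

Lemma DeltaD0 u : DeltaD eta lam1 lam2 delta1 delta2 u 0 = 0.
Proof. by rewrite /DeltaD /GRing.add_fun /optens !linear0 addr0. Qed.

Lemma DeltaDD u : {morph DeltaD eta lam1 lam2 delta1 delta2 u : v w / v + w}.
Proof.
by move=> v w; rewrite /DeltaD /GRing.add_fun /optens !linearD addrACA.
Qed.

Lemma DeltaDZ u a v : DeltaD eta lam1 lam2 delta1 delta2 u (a *: v) =
  a *: DeltaD eta lam1 lam2 delta1 delta2 u v.
Proof. by rewrite /DeltaD /GRing.add_fun /optens !linearZ scalerDr. Qed.

Lemma DeltaD_ket2 u l k : k \in Kset lam2 ->
  DeltaD eta lam1 lam2 delta1 delta2 u (ket2 l k) =
  deigen u l k *: ket2 l k +
    (eta ^+ 2 * (fcoef lam1 l * ecoef k)) *: ket2 l.+1 k.-1.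
Proof.
move=> kK; have [lK|lK] := boolP (l \in Kset lam1); last first.
  rewrite !ket2_out1 //; last by apply: contraNN lK; apply: Kset_le.
  by rewrite /DeltaD /GRing.add_fun /optens !linear0.
have DE (lam delta : C) m : evD eta lam delta u (ket lam m) =
    (u - delta - eta * (lam - m%:R)) *: ket lam m.
  by rewrite /evD /GRing.sub_fun /GRing.scale_fun /= opH_ketE scalerA -scalerBl.
rewrite /DeltaD /GRing.add_fun !optens_ket2 // !DE.
rewrite /evB /evC /GRing.scale_fun /= opF_ketE opE_ketE //.
rewrite !scalerA [X in X + _ = _]otimesZZ [X in _ + X = _]otimesZZ.
rewrite [LHS]addrC {DE}.
suff -> : eta * fcoef lam1 l * (eta * ecoef k) =
  eta ^+ 2 * (fcoef lam1 l * ecoef k) by [].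
by ring.
Qed.

End Ladder.

(* [b n.+1 = 0] is the case where the ladder leaves the representation; there
   the corresponding [g] may vanish. *)
Lemma eigen_ladder (C : fieldType) (W : lmodType C) (c d s : nat -> C)
    (b : nat -> W) k :
  s k = 0 ->
  (forall n, (n < k)%N -> b n.+1 = 0 \/ c n * s n = c n.+1 * (d 0 - d n.+1)) ->
  \sum_(0 <= n < k.+1) c n *: (d n *: b n + s n *: b n.+1) =
    d 0 *: \sum_(0 <= n < k.+1) c n *: b n.
Proof.
move=> sk0 cs; under eq_bigr => n _ do rewrite scalerDr !scalerA.
(* Splitting off the bottom term of the [d]-sum and the top term of the [s]-sum, which vanishes by
   [sk0], leaves two sums over the same vectors [b n.+1]. *)
rewrite big_split /= big_nat_recl // [X in _ + X]big_nat_recr //=.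
rewrite sk0 mulr0 scale0r addr0 -addrA -big_split /=.
rewrite scaler_sumr [RHS]big_nat_recl // scalerA mulrC; congr (_ + _).
apply: eq_big_nat => n /andP[_ /cs[->|->]]; first by rewrite !scaler0 addr0.
by rewrite -scalerDl scalerA -mulrDr addrC subrK mulrC.
Qed.

(** Characteristic zero enters because the factor [n.+1], inverted through the factorials, has to be
    cancelled. *)
Lemma vvec_eigen {C : numFieldType} {eta lam1 lam2 delta1 delta2 : C}
    (g_neq0 : forall n l k : nat, (1 <= n)%N -> (n <= k)%N ->
       l \in Kset lam1 -> k \in Kset lam2 ->
       (l + n)%N \in Kset lam1 -> (k - n)%N \in Kset lam2 ->
       gfun eta lam1 lam2 delta1 delta2 (k%:R - l%:R - n%:R) != 0)
    q u l k : l \in Kset lam1 -> k \in Kset lam2 ->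
  DeltaD eta lam1 lam2 delta1 delta2 u
    (vvec eta lam1 lam2 delta1 delta2 q l k) =
  @deigen _ eta lam1 lam2 delta1 delta2 u l k *:
    vvec eta lam1 lam2 delta1 delta2 q l k.
Proof.
move=> lK kK;
rewrite vvecE DeltaDZ (big_morph _ (DeltaDD u) (DeltaD0 u)).
rewrite scalerA [X in _ = X *: _]mulrC -scalerA; congr (_ *: _).
pose s n := eta ^+ 2 * (fcoef lam1 (l + n) * ecoef (k - n)).
pose d n := @deigen _ eta lam1 lam2 delta1 delta2 u (l + n) (k - n).
pose b n := ket2 lam1 lam2 (l + n) (k - n).
have Db n :
    DeltaD eta lam1 lam2 delta1 delta2 u (b n) = d n *: b n + s n *: b n.+1.
  rewrite /b DeltaD_ket2 ?addnS ?subnS //; exact: Kset_le (leq_subr _ _) kK.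
under eq_bigr => n _ do rewrite DeltaDZ Db.
have <- : d 0%N = @deigen _ eta lam1 lam2 delta1 delta2 u l k.
  by rewrite /d addn0 subn0.
apply: eigen_ladder => [|n nk]; first by rewrite /s subnn /ecoef !mulr0.
have [lnK|lnK] := boolP ((l + n.+1)%N \in Kset lam1); last first.
  by left; rewrite /b ket2_out1.
have g0 := g_neq0 n.+1 l k isT nk lK kK lnK (Kset_le _ _ _ (leq_subr _ _) kK).
(* The factors [n.+1] and [g] from [deigenB] cancel the denominators in [vcoefS], leaving [eta ^+ 2]
   times the ladder coefficients, that is [s n]. *)
right; rewrite vcoefS // /d /s addn0 subn0 deigenB //.
have n0 : n.+1%:R != 0 :> C by rewrite pnatr_eq0.
move: (vcoef _ _ _) (fcoef _ _) (ecoef _) n.+1%:R (gfun _ _ _ _ _ _) g0 n0.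
by move=> c f e m g g0 m0; field; rewrite g0 m0.
Qed.

Theorem proposition3p12 (R : realType)
    (eta lam1 lam2 delta1 delta2 : R[i]) (q : nat -> nat -> R[i])
    (eta_neq0 : eta != 0)
    (g_neq0 : forall n l k : nat, (1 <= n)%N -> (n <= k)%N ->
       l \in Kset lam1 -> k \in Kset lam2 ->
       (l + n)%N \in Kset lam1 -> (k - n)%N \in Kset lam2 ->
       gfun eta lam1 lam2 delta1 delta2 (k%:R - l%:R - n%:R) != 0)
    (q_neq0 : forall l k : nat,
       l \in Kset lam1 -> k \in Kset lam2 -> q l k != 0) :
  let Finv12 := Finv eta lam1 lam2 delta1 delta2 q in
  let v := vvec eta lam1 lam2 delta1 delta2 q in
  [/\ linear Finv12,
      forall l k : nat, l \in Kset lam1 -> k \in Kset lam2 ->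
        Finv12 (ket2 lam1 lam2 l k) = v l k,
      is_basis (fun x : K lam1 * K lam2 => v (val x.1) (val x.2))
    & forall (u : R[i]) (l k : nat), l \in Kset lam1 -> k \in Kset lam2 ->
        exists c : R[i],
          DeltaD eta lam1 lam2 delta1 delta2 u (v l k) = c *: v l k].
Proof.
split.
- exact: Finv_linear.
- exact: Finv_ket2.
- exact: vvec_basis.
- by move=> u l k lK kK; eexists; apply: vvec_eigen.
Qed.
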